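(* Let $Q$ be a $\rho\times N$ integer matrix (the charge matrix of a gauged linear sigma model). The following are equivalent: (a) $Q$ satisfies the Herbst Criterion, and there is a $(\mathbb{C}^* )^\rho$-invariant holomorphic function $W:\mathbb{C}^N\to\mathbb{C}$ whose critical locus after quotienting is compact in some phase; (b) $Q$ satisfies the Herbst Criterion, and there is a $(\mathbb{C}^* )^\rho$-invariant holomorphic function $W:\mathbb{C}^N\to\mathbb{C}$ whose critical locus after quotienting is compact in every phase; (c) there exists an affine Landau-Ginzburg point, i.e. there exist an affine stable point $s$ and a $(\mathbb{C}^* )^\rho$-invariant holomorphic function $W:\mathbb{C}^N\to\mathbb{C}$ such that the induced function $W:X_s\to\mathbb{C}$ has an isolated critical point.
   Context: Setting. $Q$ is a $\rho\times N$ integer matrix of rank $r$; put $n=N-r$. It defines an action of $(\mathbb{C}^* )^\rho$ on $\mathbb{C}^N$: $\lambda\star z=(\lambda_1^{Q_{11}}\cdots\lambda_\rho^{Q_{\rho 1}}z_1,\dots,\lambda_1^{Q_{1N}}\cdots\lambda_\rho^{Q_{\rho N}}z_N)$. Let $M=\ker(Q:\mathbb{Z}^N\to\mathbb{Z}^\rho)\cong\mathbb{Z}^n$, let $A:M\to\mathbb{Z}^N$ be the inclusion, and $M_{\mathbb{R}}=M\otimes\mathbb{R}$; the extensions of $Q$ and $A$ to real vector spaces are denoted by the same letters. Quotients. Let $\mu:\mathbb{C}^N\to\mathbb{R}^N$, $\mu(z)=\frac12(|z_i|^2)_i$, and $\mu_Q=Q\circ\mu$. For $s\in \operatorname{im}Q\subset\mathbb{R}^\rho$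 (so $\operatorname{im} Q\cong\mathbb{R}^r$) set $X_s=\mu_Q^{-1}(s)/U(1)^\rho$. It is identified with the toric variety $(\mathbb{C}^N\setminus E)/(\mathbb{C}^* )^\rho$, where $E$ is the complement in $\mathbb{C}^N$ of $(\mathbb{C}^* )^N\star\mu_Q^{-1}(s)$, and $(\mathbb{C}^* )^N$ acts on $\mathbb{C}^N$ by coordinatewise multiplication. Herbst Criterion. $Q$ satisfies the Herbst Criterion if one can choose $r$ linearly independent columns $q_{i_1},\dots,q_{i_r}$ of $Q$ (with distinct indices) such that each of the other $n=N-r$ columns lies in $\mathbb{R}_{\le0}q_{i_1}+\cdots+\mathbb{R}_{\le0}q_{i_r}$. Secondary fan, phases, stability. The secondary fan is the polyhedral fan in $\operatorname{im}Q$ supported on the cone generated by the columns of $Q$, in which two points lie in the relative interior of the same cone iff they lie in exactly the same cones generated by subsets of the columns of $Q$. A phase is the relative interior of a top-dimensional ($r$-dimensional) cone of the secondary fan; a point is stable if it lies in a phase. The toric variety $X_s$ is the same, up to isomorphism, for all $s$ in a given phase. Affine points. For $s\in\operatorname{im}Q$ choose $\tilde s\in\mathbb{R}^N$ with $Q\tilde s=s$ and let $P_s=\{m\in M_{\mathbb{R}}: A(m)+\tilde s\ge0\}$ (coordinatewise; well defined up to translation). A stable point $s$ is affine if $P_s$ is (a translate of) a top-dimensional simplicial cone in $M_{\mathbb{R}}$, i.e. a cone generated by $n$ linearly independent vectors. Critical loci. A $(\mathbb{C}^* )^\rho$-invariant holomorphic function $W$ on $\mathbb{C}^N$ descends to a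 function on each $X_s$, again denoted $W$. The critical locus of $W$ after quotienting, at a stable $s$, is the image in $X_s$ of $\{z\in\mathbb{C}^N\setminus E: dW(z)=0\}$. ''$W:X_s\to\mathbb{C}$ has an isolated critical point'' means that this critical locus consists of a single point. *)

(* Defs.v *)
From HB Require Import structures.
From mathcomp Require Import all_boot all_order all_algebra.
From mathcomp Require Import complex.
From mathcomp Require Import all_classical all_reals all_analysis.
Set Implicit Arguments.
Unset Strict Implicit.
Unset Printing Implicit Defensive.
Import Order.TTheory GRing.Theory Num.Theory.
Import numFieldNormedType.Exports.
Local Open Scope classical_set_scope.
Local Open Scope ring_scope.
Local Open Scope quotient_scope.

(* The complex numbers, typed as a numClosedFieldType so that the topology and
   the normed module structure of numFieldNormedType are found. *)
Definition Cplx (R : realType) : numClosedFieldType := R[i].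

Definition realmx (R : realType) (rho N : nat) (Q : 'M[int]_(rho, N)) :
  'M[R]_(rho, N) := map_mx intr Q.

Definition charge_rank (R : realType) (rho N : nat) (Q : 'M[int]_(rho, N)) :
  nat := \rank (realmx R Q).

Definition herbst (R : realType) (rho N : nat) (Q : 'M[int]_(rho, N)) : Prop :=
  exists I : 'I_(charge_rank R Q) -> 'I_N,
    [/\ injective I,
        \rank (colsub I (realmx R Q)) = charge_rank R Q
      & forall k : 'I_N, (forall j, I j != k) ->
          exists c : 'cV[R]_(charge_rank R Q),
            (forall j, c j 0 <= 0) /\
            col k (realmx R Q) = colsub I (realmx R Q) *m c].

Definition col_cone (R : realType) (rho N : nat) (Q : 'M[int]_(rho, N))
    (S : {set 'I_N}) : set 'cV[R]_rho :=
  [set realmx R Q *m x | x in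
    [set x : 'cV[R]_N | forall i, 0 <= x i 0 /\ (i \notin S -> x i 0 = 0)]].

(* The relative interior of the cone of the secondary fan that has s in its
   relative interior. *)
Definition secondary_relint (R : realType) (rho N : nat)
    (Q : 'M[int]_(rho, N)) (s : 'cV[R]_rho) : set 'cV[R]_rho :=
  [set t | col_cone Q [set: 'I_N]%SET t /\
    forall S : {set 'I_N}, col_cone Q S t <-> col_cone Q S s].

(* The dimension of a cone is that of the linear span of its relative interior;
   the latter lies in im Q, so that it is r-dimensional as soon as it contains
   r linearly independent vectors. *)
Definition phase (R : realType) (rho N : nat) (Q : 'M[int]_(rho, N))
    (sigma : set 'cV[R]_rho) : Prop :=
  exists s : 'cV[R]_rho,
    [/\ col_cone Q [set: 'I_N]%SET s,
        sigma = secondary_relint Q s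
      & exists B : 'M[R]_(rho, charge_rank R Q),
          \rank B = charge_rank R Q /\ forall j, sigma (col j B)].

Definition stable (R : realType) (rho N : nat) (Q : 'M[int]_(rho, N))
    (s : 'cV[R]_rho) : Prop :=
  exists sigma, phase Q sigma /\ sigma s.

(* M_R is identified, through A, with the kernel of Q on R^N. *)
Definition polyhedron (R : realType) (rho N : nat) (Q : 'M[int]_(rho, N))
    (st : 'cV[R]_N) : set 'cV[R]_N :=
  [set m | realmx R Q *m m = 0 /\ forall i, 0 <= m i 0 + st i 0].

Definition affine_point (R : realType) (rho N : nat) (Q : 'M[int]_(rho, N))
    (s : 'cV[R]_rho) : Prop :=
  stable Q s /\
  exists st : 'cV[R]_N, realmx R Q *m st = s /\
  exists (v : 'cV[R]_N) (G : 'M[R]_(N, N - charge_rank R Q)),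
    [/\ realmx R Q *m v = 0, realmx R Q *m G = 0,
        \rank G = (N - charge_rank R Q)%N
      & polyhedron Q st = [set v + G *m c | c in
          [set c : 'cV[R]_(N - charge_rank R Q) | forall k, 0 <= c k 0]]].

Definition torus_act (K : fieldType) (rho N : nat) (Q : 'M[int]_(rho, N))
    (lambda : 'cV[K]_rho) (z : 'cV[K]_N) : 'cV[K]_N :=
  \col_i ((\prod_(a < rho) lambda a 0 ^ Q a i) * z i 0).

Definition in_torus (K : fieldType) (n : nat) (lambda : 'cV[K]_n) : Prop :=
  forall a, lambda a 0 != 0.

Definition in_compact_torus (R : realType) (n : nat)
    (u : 'cV[Cplx R]_n) : Prop :=
  forall a, `|u a 0| = 1.

Definition moment (R : realType) (N : nat) (z : 'cV[Cplx R]_N) : 'cV[R]_N :=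
  \col_i (2^-1 * (complex.Re (z i 0) ^+ 2 + complex.Im (z i 0) ^+ 2)).

Definition moment_fiber (R : realType) (rho N : nat) (Q : 'M[int]_(rho, N))
    (s : 'cV[R]_rho) : set 'cV[Cplx R]_N :=
  [set z | realmx R Q *m moment z = s].

Definition gauge_eq (R : realType) (rho N : nat) (Q : 'M[int]_(rho, N))
    (s : 'cV[R]_rho) : rel (moment_fiber Q s) :=
  fun w w' => `[< exists u : 'cV[Cplx R]_rho,
    in_compact_torus u /\ set_val w' = torus_act Q u (set_val w) >].

Lemma torus_act1 (K : fieldType) (rho N : nat) (Q : 'M[int]_(rho, N))
  (z : 'cV[K]_N) : torus_act Q (const_mx 1) z = z.
Proof.
apply/colP => i; rewrite mxE big1 ?mul1r// => a _.
by rewrite mxE exp1rz.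
Qed.

Lemma torus_actM (K : fieldType) (rho N : nat) (Q : 'M[int]_(rho, N))
  (l m : 'cV[K]_rho) (z : 'cV[K]_N) :
  torus_act Q l (torus_act Q m z) = torus_act Q (\col_a (l a 0 * m a 0)) z.
Proof.
apply/colP => i; rewrite !mxE mulrA -big_split/=; congr (_ * _).
by apply: eq_bigr => a _; rewrite mxE expfzMl.
Qed.

Lemma gauge_eq_refl (R : realType) (rho N : nat) (Q : 'M[int]_(rho, N))
  (s : 'cV[R]_rho) : reflexive (@gauge_eq R rho N Q s).
Proof.
move=> w; apply/asboolP; exists (const_mx 1); rewrite torus_act1; split => //.
by move=> a; rewrite mxE normr1.
Qed.

Lemma gauge_eq_sym (R : realType) (rho N : nat) (Q : 'M[int]_(rho, N))
  (s : 'cV[R]_rho) : symmetric (@gauge_eq R rho N Q s).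
Proof.
suff H w w' : @gauge_eq R rho N Q s w w' -> gauge_eq w' w.
  by move=> w w'; apply/idP/idP; exact: H.
move=> /asboolP[u [u1 E]]; apply/asboolP; exists (\col_a (u a 0)^-1).
split=> [a|]; first by rewrite mxE normfV u1 invr1.
rewrite E torus_actM -[LHS](torus_act1 Q); congr torus_act.
apply/colP => a; rewrite !mxE mulVf// -normr_eq0 u1; exact: oner_neq0.
Qed.

Lemma gauge_eq_trans (R : realType) (rho N : nat) (Q : 'M[int]_(rho, N))
  (s : 'cV[R]_rho) : transitive (@gauge_eq R rho N Q s).
Proof.
move=> w2 w1 w3 /asboolP[u [u1 E1]] /asboolP[v [v1 E2]]; apply/asboolP.
exists (\col_a (v a 0 * u a 0)); rewrite E2 E1 torus_actM; split=> // a.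
by rewrite mxE normrM u1 v1 mulr1.
Qed.

Canonical gauge_equiv (R : realType) (rho N : nat) (Q : 'M[int]_(rho, N))
    (s : 'cV[R]_rho) : equiv_rel (moment_fiber Q s) :=
  EquivRel (@gauge_eq R rho N Q s) (@gauge_eq_refl R rho N Q s)
    (@gauge_eq_sym R rho N Q s) (@gauge_eq_trans R rho N Q s).

Definition toric_quotient (R : realType) (rho N : nat)
    (Q : 'M[int]_(rho, N)) (s : 'cV[R]_rho) : topologicalType :=
  quotient_topology {eq_quot @gauge_equiv R rho N Q s}.

Definition toric_class (R : realType) (rho N : nat)
    (Q : 'M[int]_(rho, N)) (s : 'cV[R]_rho) (w : moment_fiber Q s) :
    toric_quotient Q s :=
  \pi_(quotient_topology {eq_quot @gauge_equiv R rho N Q s}) w.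

Definition unstable_locus (R : realType) (rho N : nat)
    (Q : 'M[int]_(rho, N)) (s : 'cV[R]_rho) : set 'cV[Cplx R]_N :=
  ~` [set z | exists t w : 'cV[Cplx R]_N,
        [/\ in_torus t, moment_fiber Q s w & z = \col_i (t i 0 * w i 0)]].

Definition holomorphic (R : realType) (N : nat)
    (W : 'cV[Cplx R]_N -> Cplx R) : Prop :=
  forall z, differentiable W z.

Definition torus_invariant (R : realType) (rho N : nat)
    (Q : 'M[int]_(rho, N)) (W : 'cV[Cplx R]_N -> Cplx R) : Prop :=
  forall lambda z, in_torus lambda -> W (torus_act Q lambda z) = W z.

(* Under the identification of X_s with the quotient of C^N \ E by the complex
   torus, a point z outside of E is sent to the class of any point w of the
   moment fiber that lies in its complex torus orbit. *)
Definition critical_locus (R : realType) (rho N : nat)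
    (Q : 'M[int]_(rho, N)) (W : 'cV[Cplx R]_N -> Cplx R) (s : 'cV[R]_rho) :
    set (toric_quotient Q s) :=
  [set x | exists (z : 'cV[Cplx R]_N) (lambda : 'cV[Cplx R]_rho)
      (w : moment_fiber Q s),
    [/\ ~ unstable_locus Q s z, forall v, 'd W z v = 0, in_torus lambda,
        set_val w = torus_act Q lambda z & x = toric_class w]].

Arguments critical_locus {R rho N} Q W s.

(* Up to isomorphism, X_s and the critical locus do not depend on the choice of
   s in the phase sigma, which is nonempty. *)
Definition compact_critical_locus_in (R : realType) (rho N : nat)
    (Q : 'M[int]_(rho, N)) (W : 'cV[Cplx R]_N -> Cplx R)
    (sigma : set 'cV[R]_rho) : Prop :=
  forall s, sigma s -> compact (critical_locus Q W s).

(* Main.v *)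
(* All three conditions are equivalent to the Herbst Criterion alone, with one
   superpotential that works in every phase.  Let [I] index the [r] independent
   columns and [L] be an integer matrix with [L Q_I = D], [D > 0]; for [k] not in
   [I] the criterion says that [e_kj := - (L Q)_jk] is nonnegative, so that
   [S_k := z_k^D prod_j z_(I j)^e_kj] is an invariant monomial.  Take
   [W := sum_k S_k^2].  As [z_k] occurs only in [S_k], applying the Euler field
   [z_k d/dz_k] to [W] shows that the critical set of [W] is exactly [{S_k = 0
   for all k}].  In terms of [x := moment z], the equation [Q x = s] reads
   [D x_(I j) = (L s)_j + sum_k e_kj x_k]; if [S_k = 0] then either [x_k = 0], or
   [x_(I j) = 0] for some [j] with [e_kj > 0], which bounds [x_k].  So the
   critical locus is compact for every [s].  For [s := sum_j q_(I j)] no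
   [x_(I j)] can vanish, hence all [x_k] do, and a single orbit remains.

   Conversely, if [P_s] is a simplicial cone with apex [p] and [s] is stable,
   then the columns of [Q] in the support of [p] form a basis of [im Q], and the
   rays of the cone express the other columns with nonpositive coefficients. *)
Require Import Defs.
From mathcomp Require Import all_boot all_order all_algebra.
From mathcomp Require Import complex ring lra.
From mathcomp Require Import all_classical all_reals all_analysis.
Set Implicit Arguments.
Unset Strict Implicit.
Unset Printing Implicit Defensive.
Import Order.TTheory GRing.Theory Num.Theory.
Import numFieldNormedType.Exports.
Local Open Scope classical_set_scope.
Local Open Scope ring_scope.
(* MathComp uses the name [realmx] for the qualifier of real matrices. *)
Local Notation realmx := Defs.realmx.

(** * Topology of complex column vectors and of the moment fibers *)

(** Push the filter forward along [set_val]: its cluster point lies in [K], hence in [A], and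
    lifts. *)
Lemma compact_subtype (X : topologicalType) (A K : set X) :
  K `<=` A -> compact K -> compact (@set_val _ A @^-1` K).
Proof.
move=> KA Kco F FF FK.
have GK : (@set_val _ A @ F) K by [].
have [p [Kp clp]] := Kco _ _ GK.
have pA : p \in A by rewrite inE; exact: KA.
exists (exist _ p pA); split => //.
move=> C D FC /= [_ [[U oU <-] Up UD]].
have GC : (@set_val _ A @ F) (@set_val _ A @` C).
  by apply: (@filterS _ F _ C _ _ FC); exact: preimage_image.
have [_ [[x Cx <-] Ux]] := clp _ _ GC (open_nbhs_nbhs (conj oU Up)).
by exists x; split => //; exact: UD.
Qed.

Section ComplexTopology.
Variable R : realType.
Local Notation C := (Cplx R).

Lemma normC_real (x : R) : `|x%:C%C : C| = `|x|%:C%C.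
Proof. by rewrite normc_def /= expr0n addr0 sqrtr_sqr. Qed.

Lemma real_complex_continuous : continuous (fun x : R => x%:C%C : C).
Proof.
move=> x; apply/cvgrPdist_lt => e; rewrite ltcE /= => /andP[/eqP ime re0].
near=> y.
rewrite -rmorphB /= normC_real ltcE /= -ime eqxx /=.
near: y; apply: cvgr_dist_lt => //; exact: cvg_id.
Unshelve. all: by end_near. Qed.

Lemma Re_continuous : continuous (@complex.Re R : C -> R).
Proof.
move=> x; apply/(@cvgrPdist_lt _ _ _ (nbhs x) (nbhs_filter x)) => e e0.
near=> y.
rewrite -ltcR -raddfB; apply: le_lt_trans (normc_ge_Re _) _.
near: y; apply: (@cvgr_dist_lt _ _ _ (nbhs x) (nbhs_filter x) id).
  exact: cvg_id.
by rewrite ltcR.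
Unshelve. all: by end_near. Qed.

Lemma Im_continuous : continuous (@complex.Im R : C -> R).
Proof.
move=> x.
have -> : (@complex.Im R : C -> R) = (@complex.Re R : C -> R) \o (fun z : C => - 'i%C * z).
  by apply/funext => -[a b] /=; lra.
apply: continuous_comp; last exact: Re_continuous.
apply: (@cvgM _ _ (nbhs x) _); [exact: cvg_cst|exact: cvg_id].
Qed.

Lemma complex_box_compact (M : R) :
  compact [set z : C | `|complex.Re z| <= M /\ `|complex.Im z| <= M].
Proof.
have cf : continuous (fun p : R * R => (p.1 +i* p.2)%C : C).
  have -> : (fun p : R * R => (p.1 +i* p.2)%C : C) =
     (fun p : R * R => (p.1%:C%C : C) + 'i%C * p.2%:C%C).
    apply/funext => -[a b] /=; apply/eqP; rewrite eq_complex /=.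
    by apply/andP; split; apply/eqP; lra.
  move=> p; apply: cvgD.
    apply: (@continuous_comp _ _ _ fst (fun x : R => x%:C%C : C)).
      exact: cvg_fst.
    exact: real_complex_continuous.
  apply: cvgM; first exact: cvg_cst.
  apply: (@continuous_comp _ _ _ snd (fun x : R => x%:C%C : C)).
    exact: cvg_snd.
  exact: real_complex_continuous.
have := @continuous_compact _ _ _ (`[(- M), M] `*` `[(- M), M]) (continuous_subspaceT cf)
  (compact_setX (@segment_compact _ _ _) (@segment_compact _ _ _)).
congr compact; apply/seteqP; split => [_ [[a b] /= [+ + <-]] /=|[a b] /= [ha hb]].
  by rewrite !in_itv /= -!ler_norml.
by exists (a, b) => //=; split; rewrite in_itv/= -ler_norml.
Qed.

Lemma cV_compact (N : nat) (A : 'I_N -> set C) :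
  (forall i, compact (A i)) -> compact [set v : 'cV[C]_N | forall i, A i (v i 0)].
Proof.
move=> cA.
have ct : continuous (fun v : 'rV[C]_N => v^T : 'cV[C]_N).
  move=> v B [P Pv PB]; exists (fun i j => P j i).
    by move=> i j; have := Pv j i; rewrite mxE.
  by move=> u uP; apply: PB => i j; rewrite mxE; exact: uP.
have := continuous_compact (continuous_subspaceT ct) (rV_compact cA).
congr compact; apply/seteqP; split => [_ [v /= hv <-] i|v /= hv]; first by rewrite mxE.
by exists v^T; rewrite ?trmxK// => i; rewrite mxE.
Qed.

Lemma moment_continuous (N : nat) (i : 'I_N) :
  continuous (fun z : 'cV[C]_N => moment z i 0 : R).
Proof.
have -> : (fun z : 'cV[C]_N => moment z i 0 : R) =
  (fun z : 'cV[C]_N => 2^-1 * (complex.Re (z i 0) * complex.Re (z i 0)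
      + complex.Im (z i 0) * complex.Im (z i 0))).
  by apply/funext => z; rewrite mxE !expr2.
have cr : continuous (fun z : 'cV[C]_N => complex.Re (z i 0) : R).
  by move=> z; apply: continuous_comp; [exact: coord_continuous|exact: Re_continuous].
have ci : continuous (fun z : 'cV[C]_N => complex.Im (z i 0) : R).
  by move=> z; apply: continuous_comp; [exact: coord_continuous|exact: Im_continuous].
move=> z; apply: (@cvgM _ _ (nbhs z) _); first exact: cvg_cst.
by apply: cvgD; apply: cvgM; [exact: cr|exact: cr|exact: ci|exact: ci].
Qed.

Lemma moment_fiber_closed (rho N : nat) (Q : 'M[int]_(rho, N)) (s : 'cV[R]_rho) :
  closed (moment_fiber Q s).
Proof.
have -> : moment_fiber Q s = \bigcap_(a in [set: 'I_rho])
    [set z : 'cV[C]_N | \sum_i realmx R Q a i * moment z i 0 = s a 0].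
  apply/seteqP; split => [z /= <- a _ /=|z /= h]; first by rewrite mxE.
  by apply/colP => a; rewrite mxE; exact: h.
apply: closed_bigI => a _.
apply: (@preimage_closed _ _ (fun z : 'cV[C]_N =>
  \sum_i realmx R Q a i * moment z i 0) [set x | x = s a 0]); last exact: closed_eq.
move=> z _; move: z.
apply: continuous_big => [|i _]; first exact: add_continuous.
move=> z; apply: (@cvgM _ _ (nbhs z) _); first exact: cvg_cst.
exact: moment_continuous.
Qed.

End ComplexTopology.

(** * Sums of squares of monomials *)

Definition monomial (K : comPzRingType) (N : nat) (m : 'I_N -> nat)
  (z : 'cV[K]_N) : K := \prod_i z i 0 ^+ m i.

Section Differential.
Variables (K : numFieldType) (N : nat).
Implicit Types (f g : 'cV[K]_N -> K) (z v : 'cV[K]_N).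

Lemma diff_coord z v i :
  'd (fun M : 'cV[K]_N => M i 0 : K) z v = v i 0.
Proof.
have @f : {linear 'cV[K]_N -> K}.
  by exists (fun M : 'cV[K]_N => M i 0); do 2![eexists]; do ?[constructor];
     rewrite ?mxE// => ? *; rewrite ?mxE//; move=> ?; rewrite !mxE.
rewrite (_ : (fun _ => _) = f) // diff_lin //; exact: coord_continuous.
Qed.

Lemma diff_mulE f g z v : differentiable f z -> differentiable g z ->
  'd (fun x => f x * g x) z v = f z * 'd g z v + g z * 'd f z v.
Proof.
by move=> df dg; rewrite (_ : (fun _ => _) = f * g)// diffM.
Qed.

Lemma differentiable_sum_seq (I : Type) (r : seq I) (P : pred I)
    (F : I -> 'cV[K]_N -> K) z : (forall i, P i -> differentiable (F i) z) ->
  differentiable (fun x => \sum_(i <- r | P i) F i x) z.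
Proof.
move=> dF; rewrite (_ : (fun _ => _) = \sum_(i <- r | P i) F i).
  by elim/big_ind: _ => [|f g|//]; [exact: differentiable_cst|exact: differentiableD].
by apply/funext => x; rewrite fct_sumE.
Qed.

Lemma diff_sumE (I : Type) (r : seq I) (P : pred I) (F : I -> 'cV[K]_N -> K)
    z v : (forall i, P i -> differentiable (F i) z) ->
  'd (fun x => \sum_(i <- r | P i) F i x) z v = \sum_(i <- r | P i) 'd (F i) z v.
Proof.
move=> dF; elim: r => [|i r IH].
  rewrite big_nil (_ : (fun _ => _) = cst 0) ?diff_cst//.
  by apply/funext => x; rewrite big_nil.
rewrite big_cons; case: ifPn => Pi.
  rewrite -IH (_ : (fun _ => _) = F i + (fun x => \sum_(i <- r | P i) F i x)).
    by rewrite diffD//; [exact: dF|exact: differentiable_sum_seq].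
  by apply/funext => x; rewrite big_cons Pi.
rewrite -IH; congr ('d _ z v); apply/funext => x.
by rewrite big_cons (negPf Pi).
Qed.

(* Monomials satisfy this for [v = z_k e_k], [c] being the exponent of [z_k]. *)
Definition eigendirection z v f c := differentiable f z /\ 'd f z v = c * f z.

Lemma eigendirectionM f g z v c d :
  eigendirection z v f c -> eigendirection z v g d ->
  eigendirection z v (fun x => f x * g x) (c + d).
Proof.
move=> [df ef] [dg eg]; split; first exact: differentiableM.
by rewrite diff_mulE// eg ef; ring.
Qed.

Lemma eigendirection1 z v : eigendirection z v (fun=> 1) 0.
Proof.
split; first exact: differentiable_cst.
by rewrite (_ : (fun _ => _) = cst 1)// diff_cst mul0r.
Qed.

Lemma eigendirectionX f z v c n :
  eigendirection z v f c -> eigendirection z v (fun x => f x ^+ n) (c *+ n).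
Proof.
move=> ef; elim: n => [|n IH].
  rewrite mulr0n (_ : (fun _ => _) = fun=> 1); first exact: eigendirection1.
  by apply/funext => x; rewrite expr0.
rewrite mulrS (_ : (fun _ => _) = fun x => f x * f x ^+ n).
  exact: eigendirectionM.
by apply/funext => x; rewrite exprS.
Qed.

Lemma eigendirection_prod (I : Type) (r : seq I) (F : I -> 'cV[K]_N -> K)
    (c : I -> K) z v : (forall i, eigendirection z v (F i) (c i)) ->
  eigendirection z v (fun x => \prod_(i <- r) F i x) (\sum_(i <- r) c i).
Proof.
move=> eF; elim: r => [|i r IH].
  rewrite big_nil (_ : (fun _ => _) = fun=> 1); first exact: eigendirection1.
  by apply/funext => x; rewrite big_nil.
rewrite big_cons (_ : (fun _ => _) = fun x => F i x * \prod_(i <- r) F i x).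
  exact: eigendirectionM.
by apply/funext => x; rewrite big_cons.
Qed.

(** The coordinate [z_i] has eigenvalue 1 if [i = k] and 0 otherwise along the Euler direction of
    [z_k]; eigenvalues of factors add up. *)
Lemma eigendirection_monomial m z k :
  eigendirection z (z k 0 *: delta_mx k 0) (monomial m) (m k)%:R.
Proof.
have -> : (m k)%:R = \sum_i (i == k)%:R *+ m i :> K.
  rewrite (bigD1 k)//= eqxx big1 ?addr0// => i /negPf ->; exact: mul0rn.
apply: eigendirection_prod => i; apply: eigendirectionX.
split; first exact: differentiable_coord.
rewrite diff_coord !mxE andbT mulrC.
by case: eqVneq => [->|]//; rewrite !mul0r.
Qed.

Lemma differentiable_monomial m z : differentiable (monomial m : 'cV[K]_N -> K) z.
Proof.
(* Along the zero direction every coordinate has eigenvalue 0, so [eigendirection_prod] yields the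
   differentiability. *)
have [|//] := @eigendirection_prod _ (index_enum 'I_N)
  (fun i x => x i 0 ^+ m i) (fun i => 0 *+ m i) z 0.
move=> i; apply: eigendirectionX.
by split; [exact: differentiable_coord | rewrite diff_coord mxE mul0r].
Qed.

Definition monomial_square_sum (P : pred 'I_N) (m : 'I_N -> 'I_N -> nat) z : K :=
  \sum_(k | P k) monomial (m k) z * monomial (m k) z.

Lemma differentiable_monomial_square_sum P m z :
  differentiable (monomial_square_sum P m) z.
Proof.
apply: differentiable_sum_seq => k _; apply: differentiableM;
  exact: differentiable_monomial.
Qed.

(** Squares make each common zero of the monomials critical, since [d(S^2) = 2 S dS]. Conversely,
    along the Euler direction of [z_k] the other monomials have zero derivative, and [dW = 0]
    becomes [2 m_kk S_k^2 = 0]. *)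
Lemma diff_monomial_square_sum_eq0 (P : pred 'I_N) (m : 'I_N -> 'I_N -> nat) z :
  (forall k, P k -> (0 < m k k)%N) ->
  (forall k l, P k -> P l -> k != l -> m k l = 0%N) ->
  (forall v, 'd (monomial_square_sum P m) z v = 0) <->
  (forall k, P k -> monomial (m k) z = 0).
Proof.
move=> mkk mkl.
have dW v : 'd (monomial_square_sum P m) z v =
    \sum_(k | P k) 2 * monomial (m k) z * 'd (monomial (m k)) z v.
  rewrite diff_sumE => [|k _]; last first.
    by apply: differentiableM; exact: differentiable_monomial.
  apply: eq_bigr => k _; rewrite diff_mulE; try exact: differentiable_monomial.
  by ring.
split=> [dW0 k Pk|S0 v]; last by rewrite dW big1// => k /S0 ->; rewrite mulr0 mul0r.
have := dW0 (z k 0 *: delta_mx k 0).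
rewrite dW (bigD1 k)//= big1 ?addr0 => [|l /andP[Pl lk]]; last first.
  by have [_ ->] := eigendirection_monomial (m l) z k; rewrite mkl// !mul0r mulr0.
have [_ ->] := eigendirection_monomial (m k) z k.
move/eqP; rewrite !mulf_eq0 !pnatr_eq0 /= eqn0Ngt mkk//= orbb.
by move/eqP.
Qed.

End Differential.

(** * Integral form of the Herbst Criterion *)

Lemma enum_injection (T : finType) (A : {set T}) n : #|A| = n ->
  exists2 J : 'I_n -> T, injective J & forall x, (x \in codom J) = (x \in A).
Proof.
case: _ /; exists enum_val; first exact: enum_val_inj.
move=> x; apply/codomP/idP => [[i ->]|xA]; first exact: enum_valP.
by exists (enum_rank_in xA x); rewrite enum_rankK_in.
Qed.

(** The factor [colsub f 1%:M] serves below as the embedding of coefficient vectors into the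
    coordinates indexed by [f]. *)
Lemma colsub_mul (K : pzSemiRingType) (m n p : nat) (A : 'M[K]_(m, n)) (f : 'I_p -> 'I_n) :
  colsub f A = A *m colsub f 1%:M.
Proof.
apply/matrixP => i j; rewrite !mxE (bigD1 (f j))//= !mxE eqxx mulr1.
by rewrite big1 ?addr0// => k /negPf kf; rewrite !mxE kf mulr0.
Qed.

Lemma col_mulmx (K : pzSemiRingType) (m n p : nat) (A : 'M[K]_(m, n)) (B : 'M[K]_(n, p)) j :
  col j (A *m B) = A *m col j B.
Proof. by apply/colP => i; rewrite !mxE; apply: eq_bigr => k _; rewrite !mxE. Qed.

Lemma colsub1_mul_in (K : pzSemiRingType) (n p : nat) (f : 'I_p -> 'I_n)
    (c : 'cV[K]_p) j :
  injective f -> (colsub f 1%:M *m c) (f j) 0 = c j 0.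
Proof.
move=> fI; rewrite mxE (bigD1 j)//= !mxE eqxx mul1r big1 ?addr0// => j' j'j.
by rewrite !mxE (inj_eq fI) eq_sym (negPf j'j) mul0r.
Qed.

Lemma colsub1_mul_notin (K : pzSemiRingType) (n p : nat) (f : 'I_p -> 'I_n)
    (c : 'cV[K]_p) l :
  l \notin codom f -> (colsub f 1%:M *m c) l 0 = 0.
Proof.
move=> lf; rewrite mxE big1// => j _; rewrite !mxE.
case: eqVneq => [lE|]; last by rewrite mul0r.
by rewrite lE codom_f in lf.
Qed.

Lemma big_codom (V : nmodType) (T T' : finType) (f : T -> T') (F : T' -> V) :
  injective f -> \sum_(l in codom f) F l = \sum_j F (f j).
Proof.
move=> fI; transitivity (\sum_(l in f @: [set: T]%SET) F l).
  apply: eq_bigl => l; apply/codomP/imsetP => [[j ->]|[j _ ->]]; last by exists j.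
  by exists j; rewrite ?inE.
rewrite big_imset /=; last by move=> i j _ _; exact: fI.
by apply: eq_bigl => j; rewrite !inE.
Qed.

Lemma rat_common_denominator (p q : nat) (B : 'M[rat]_(p, q)) :
  exists2 D : nat, (0 < D)%N &
    exists L : 'M[int]_(p, q), map_mx intr L = D%:R *: B.
Proof.
pose D := (\prod_(ij : 'I_p * 'I_q) `|denq (B ij.1 ij.2)|)%N.
exists D; first by apply/prodn_gt0 => ij; rewrite absz_gt0 denq_neq0.
exists (\matrix_(i, j) (numq (B i j) *
  (\prod_(ij | ij != (i, j)) `|denq (B ij.1 ij.2)|%N)%:Z)).
apply/matrixP => i j; rewrite 2!mxE [RHS]mxE.
have -> : D = (`|denq (B i j)| * \prod_(ij | ij != (i, j)) `|denq (B ij.1 ij.2)|)%N.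
  by rewrite /D (bigD1 (i, j)).
rewrite natrM.
rewrite intrM numqE -[(`|_|%N)%:R]/(`|denq (B i j)|%N%:Z%:~R) absz_denq.
by rewrite -pmulrn; ring.
Qed.

(** The rank is the same over the rationals and the reals, so a rational left inverse exists;
    clearing its denominators gives [L]. *)
Lemma int_left_inverse (R : realType) (p q : nat) (A : 'M[int]_(p, q)) :
  \rank (map_mx intr A : 'M[R]_(p, q)) = q ->
  exists2 D : nat, (0 < D)%N & exists L : 'M[int]_(q, p), L *m A = D%:Z%:M.
Proof.
have -> : map_mx intr A = map_mx ratr (map_mx intr A : 'M[rat]_(p, q)) :> 'M[R]_(p, q).
  by apply/matrixP => i j; rewrite !mxE ratr_int.
rewrite mxrank_map => rA.
have /row_fullP[B BA] : row_full (map_mx intr A : 'M[rat]_(p, q)) by rewrite /row_full rA.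
have [D D0 [L LB]] := rat_common_denominator B.
exists D => //; exists L.
have : map_mx intr (L *m A) = map_mx intr (D%:Z%:M) :> 'M[rat]_q; last first.
  move=> /matrixP E; apply/matrixP => i j; have := E i j.
  by rewrite [LHS]mxE [RHS]mxE => /intr_inj.
rewrite map_mxM/= LB -scalemxAl BA map_scalar_mx /= scalemx1.
by rewrite -pmulrn.
Qed.

Section HerbstData.
Variables (rho N r : nat) (Q : 'M[int]_(rho, N)) (I : 'I_r -> 'I_N).
Variables (L : 'M[int]_(r, rho)) (D : nat).

(* [L / D] inverts the columns indexed by [I], so the coefficients of the other
   columns on these are the entries of [L *m Q] divided by [D]. *)
Record integral_herbst : Prop := IntegralHerbst {
  ih_inj : injective I ;
  ih_D : (0 < D)%N ;
  ih_inv : L *m colsub I Q = D%:Z%:M ;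
  ih_le0 : forall k j, k \notin codom I -> (L *m Q) j k <= 0 ;
  ih_col : forall k, k \notin codom I ->
    colsub I Q *m (L *m col k Q) = D%:Z *: col k Q
}.

(** The exponent of [z_l] in [S_k], for [k] outside [I]. For injective [I] the sum has at most one
    term; the absolute value turns the nonpositive [(L Q)_jk] into the natural number [e_kj]. *)
Definition herbst_exponent (k l : 'I_N) : nat :=
  D * (l == k) + \sum_(j | I j == l) `|(L *m Q) j k|%N.

Hypothesis ih : integral_herbst.
Local Notation m := herbst_exponent.

Lemma herbst_exponentI k j : k \notin codom I -> m k (I j) = `|(L *m Q) j k|%N.
Proof.
move=> kI; rewrite /m; have -> /= : (I j == k) = false.
  by apply: contraNF kI => /eqP <-; exact: codom_f.
rewrite muln0 add0n (bigD1 j)//= big1 ?addn0// => i /andP[/eqP/(ih_inj ih) ->].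
by rewrite eqxx.
Qed.

Lemma herbst_exponentN k l : k \notin codom I -> l \notin codom I ->
  m k l = (D * (l == k))%N.
Proof.
move=> kI lI; rewrite /m big1 ?addn0// => j /eqP jl.
by rewrite -jl codom_f in lI.
Qed.

(** This is the invariance of [S_k] at the level of exponents: [ih_col] expands [D q_k] in the
    columns of [I] with coefficients [(L Q)_jk = - e_kj], so the two parts of the sum cancel. *)
Lemma herbst_exponent_charge k a : k \notin codom I ->
  \sum_l Q a l * (m k l)%:Z = 0.
Proof.
move=> kI; rewrite (bigID (mem (codom I)))/=.
have -> : \sum_(l | l \notin codom I) Q a l * (m k l)%:Z = D%:Z * Q a k.
  rewrite (bigD1 k)//= herbst_exponentN// eqxx muln1 big1 ?addr0 ?(mulrC D%:Z)//.
  by move=> l /andP[lI lk]; rewrite herbst_exponentN// (negPf lk) muln0 mulr0.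
have -> : \sum_(l in codom I) Q a l * (m k l)%:Z =
    - \sum_j Q a (I j) * (L *m Q) j k.
  rewrite (big_codom _ (ih_inj ih)) -sumrN; apply: eq_bigr => j _.
  by rewrite herbst_exponentI// lez0_abs ?(ih_le0 ih)// mulrN.
have := congr1 (fun M : 'cV_rho => M a 0) (ih_col ih kI).
rewrite !mxE => <-; apply/eqP; rewrite addrC subr_eq0; apply/eqP.
apply: eq_bigr => j _; rewrite !mxE; congr (_ * _).
by apply: eq_bigr => b _; rewrite mxE.
Qed.

Variable (R : realType).
Local Notation Qr := (realmx R Q).

(** Row [j] of [L Q] is [D] at [I j], zero at the rest of [I] and [- e_kj] at each [k] outside. The
    later bounds and positivity statements on fibers rest on this equation. *)
Lemma fiber_coord (x : 'cV[R]_N) j :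
  D%:R * x (I j) 0 = (map_mx intr L *m (Qr *m x)) j 0 +
    \sum_(k | k \notin codom I) (m k (I j))%:R * x k 0.
Proof.
rewrite mulmxA /Qr -map_mxM mxE (bigID (mem (codom I)))/=.
rewrite -addrA -big_split/= [X in _ + X]big1 ?addr0; last first.
  move=> k kI; rewrite herbst_exponentI// mxE.
  rewrite -[(`|_|%N)%:R]/((`|(L *m Q) j k|%N)%:Z%:~R) lez0_abs ?(ih_le0 ih)//.
  by rewrite rmorphN/= mulNr subrr.
rewrite (big_codom _ (ih_inj ih)) (bigD1 j)//= big1 ?addr0 => [|j' j'j].
  have /matrixP/(_ j j) := ih_inv ih; rewrite colsub_mul mulmxA -colsub_mul !mxE eqxx => ->.
  by rewrite pmulrn.
have /matrixP/(_ j j') := ih_inv ih.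
rewrite colsub_mul mulmxA -colsub_mul !mxE eq_sym (negPf j'j) mulr0n => ->.
by rewrite mul0r.
Qed.
End HerbstData.

(** Applying [L] to [q_k = Q_I c] gives [L q_k = D c]: up to the positive factor [D], the real
    coefficients of the criterion are the integers [(L Q)_jk], with the same signs. *)
Lemma herbst_integral (R : realType) (rho N : nat) (Q : 'M[int]_(rho, N)) :
  herbst R Q -> exists (I : 'I_(charge_rank R Q) -> 'I_N)
    (L : 'M[int]_(charge_rank R Q, rho)) (D : nat), integral_herbst Q I L D.
Proof.
move=> [I [Iinj rI Icone]].
have QI : map_mx intr (colsub I Q) = colsub I (realmx R Q).
  by apply/matrixP => i j; rewrite !mxE.
have [|D D0 [L LQ]] := @int_left_inverse R _ _ (colsub I Q); first by rewrite QI.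
exists I, L, D.
have LQr : map_mx intr L *m colsub I (realmx R Q) = D%:R%:M.
  by rewrite -QI -map_mxM LQ map_scalar_mx /= -pmulrn.
have Lcol k : k \notin codom I -> exists c : 'cV[R]_(charge_rank R Q),
    [/\ forall j, c j 0 <= 0, col k (realmx R Q) = colsub I (realmx R Q) *m c
      & map_mx intr L *m col k (realmx R Q) = D%:R *: c].
  move=> kI; have [j|c [c0 cE]] := Icone k.
    by apply: contraNneq kI => <-; exact: codom_f.
  by exists c; split=> //; rewrite cE mulmxA LQr mul_scalar_mx.
split=> // [k j kI|k kI].
  have [c [c0 _ /colP/(_ j)]] := Lcol k kI.
  rewrite -(ler_int R) !mxE => E.
  rewrite (_ : (\sum_i _)%:~R = D%:R * c j 0).
    by rewrite mulr_ge0_le0.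
  rewrite -E rmorph_sum/=; apply: eq_bigr => a _.
  by rewrite !mxE rmorphM.
have [c [_ cE Lc]] := Lcol k kI.
apply/colP => a; apply: (@intr_inj R).
have := congr1 (fun M : 'cV[R]_rho => (D%:R *: M) a 0) cE; rewrite scalemxAr -Lc mxE.
rewrite -QI -map_col -!map_mxM => E.
rewrite [in RHS]mxE rmorphM/= -pmulrn.
by move: E; rewrite [RHS]mxE mxE => ->.
Qed.

(** * The superpotential *)

Lemma monomial_eq0P (K : idomainType) (N : nat) (m : 'I_N -> nat) (z : 'cV[K]_N) :
  reflect (exists2 l, m l != 0%N & z l 0 = 0) (monomial m z == 0).
Proof.
rewrite /monomial; apply: (iffP (prodf_eq0 _ _)) => [[l _]|[l ml zl]].
  by rewrite expf_eq0 lt0n => /andP[? /eqP ?]; exists l.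
by exists l => //; rewrite zl expf_eq0 lt0n ml eqxx.
Qed.

Lemma monomial_torus_act (K : fieldType) (rho N : nat) (Q : 'M[int]_(rho, N))
    (m : 'I_N -> nat) (lambda : 'cV[K]_rho) (z : 'cV[K]_N) :
  in_torus lambda -> (forall a, \sum_l Q a l * (m l)%:Z = 0) ->
  monomial m (torus_act Q lambda z) = monomial m z.
Proof.
move=> l0 Qm; rewrite /monomial.
under eq_bigr => l _ do rewrite mxE exprMn.
rewrite big_split/= [X in X * _](_ : _ = 1) ?mul1r//.
under eq_bigr => l _ do rewrite -prodrXl.
rewrite exchange_big/= big1// => a _.
under eq_bigr => l _ do rewrite exprnP exprz_exp.
have -> : \prod_l lambda a 0 ^ (Q a l * (m l)%:Z) = lambda a 0 ^ (\sum_l Q a l * (m l)%:Z).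
  elim/big_rec2: _ => [|l p q _ ->]; first by rewrite expr0z.
  by rewrite expfzDr.
by rewrite Qm expr0z.
Qed.

Lemma moment_ge0 (R : realType) (N : nat) (z : 'cV[Cplx R]_N) i : 0 <= moment z i 0.
Proof. by rewrite mxE mulr_ge0 ?invr_ge0 ?addr_ge0 ?sqr_ge0. Qed.

Lemma moment_eq0 (R : realType) (N : nat) (z : 'cV[Cplx R]_N) i :
  (moment z i 0 == 0) = (z i 0 == 0).
Proof.
rewrite mxE mulf_eq0 invr_eq0 pnatr_eq0 /= paddr_eq0 ?sqr_ge0// !sqrf_eq0.
by rewrite eq_complex.
Qed.

Lemma moment_le_box (R : realType) (N : nat) (z : 'cV[Cplx R]_N) i (M : R) :
  moment z i 0 <= M ->
  `|complex.Re (z i 0)| <= 1 + 2 * M /\ `|complex.Im (z i 0)| <= 1 + 2 * M.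
Proof.
rewrite mxE; move: (complex.Re _) (complex.Im _) => x y xyM.
(* The hypothesis forces [M >= 0]; the crude bound [1 + 2 M] avoids a square root. *)
have sq (t : R) : t ^+ 2 <= 2 * M -> `|t| <= 1 + 2 * M.
  move=> tM; rewrite leNgt; apply/negP => h.
  have : 2 * M < t ^+ 2 by rewrite -[t ^+ 2]ger0_norm ?sqr_ge0// normrX; nra.
  lra.
have := sqr_ge0 x; have := sqr_ge0 y.
by split; apply: sq; lra.
Qed.

Section HerbstPotential.
Variables (R : realType) (rho N r : nat) (Q : 'M[int]_(rho, N)) (I : 'I_r -> 'I_N).
Variables (L : 'M[int]_(r, rho)) (D : nat).
Hypothesis ih : integral_herbst Q I L D.
Local Notation m := (herbst_exponent Q I L D).
Local Notation C := (Cplx R).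
Local Notation Qr := (realmx R Q).

Definition herbst_potential : 'cV[C]_N -> C :=
  monomial_square_sum [pred k | k \notin codom I] m.

Lemma herbst_potential_holomorphic : holomorphic herbst_potential.
Proof. by move=> z; exact: differentiable_monomial_square_sum. Qed.

Lemma herbst_monomial_invariant k lambda (z : 'cV[C]_N) : k \notin codom I ->
  in_torus lambda -> monomial (m k) (torus_act Q lambda z) = monomial (m k) z.
Proof.
by move=> kI l0; apply: monomial_torus_act => // a; exact: herbst_exponent_charge ih _ _ kI.
Qed.

Lemma herbst_potential_invariant : torus_invariant Q herbst_potential.
Proof.
move=> lambda z l0; apply: eq_bigr => k kI.
by rewrite herbst_monomial_invariant.
Qed.

Lemma herbst_potential_critical z : (forall v, 'd herbst_potential z v = 0) <->
  (forall k, k \notin codom I -> monomial (m k) z = 0).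
Proof.
apply: diff_monomial_square_sum_eq0 => [k kI|k l kI lI kl].
  by rewrite herbst_exponentN// eqxx muln1 (ih_D ih).
by rewrite herbst_exponentN// eq_sym (negPf kl) muln0.
Qed.

(** Vanishing of the monomials is invariant, so it passes from [z] to its representative [w] in the
    fiber; conversely a point of the fiber represents itself, with [lambda = 1]. *)
Lemma critical_locus_herbst s : critical_locus Q herbst_potential s =
  @toric_class R rho N Q s @` (set_val @^-1`
    [set w : 'cV[C]_N | forall k, k \notin codom I -> monomial (m k) w = 0]).
Proof.
apply/seteqP; split=> [_ [z [l [w [_ + l0 wE ->]]]]|_ [w /= w0 <-]].
  move=> /herbst_potential_critical dz.
  by exists w => //= k kI; rewrite wE herbst_monomial_invariant//; exact: dz.
exists (set_val w), (const_mx 1), w; split=> //.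
- apply; exists (const_mx 1), (set_val w); split.
  + by move=> i; rewrite mxE oner_neq0.
  + exact: set_valP.
  + by apply/colP => i; rewrite !mxE mul1r.
- exact/herbst_potential_critical.
- by move=> i; rewrite mxE oner_neq0.
- by rewrite torus_act1.
Qed.

Lemma herbst_fiber_bounded (s : 'cV[R]_rho) : exists M, forall x : 'cV[R]_N,
  (forall i, 0 <= x i 0) -> Qr *m x = s ->
  (forall k, k \notin codom I -> exists2 l, m k l != 0%N & x l 0 = 0) ->
  forall i, x i 0 <= M.
Proof.
pose B := \sum_j `|(map_mx intr L *m s) j 0|.
pose E := \sum_k \sum_l (m k l)%:R : R.
have B0 : 0 <= B by apply: sumr_ge0.
have leB j : `|(map_mx intr L *m s) j 0| <= B.
  by rewrite /B (bigD1 j)//= lerDl sumr_ge0.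
have D1 : 1 <= D%:R :> R by rewrite ler1n (ih_D ih).
(* Coordinates outside [I] will be at most [B]; by [fiber_coord] and [D >= 1], those in [I] are then
   at most [B + E B]. *)
exists (B * (1 + E)) => x x0 Qx kx i.
have E0 : 0 <= E by apply: sumr_ge0 => k _; apply: sumr_ge0.
have xk k : k \notin codom I -> x k 0 <= B.
  move=> kI; have [l mkl xl] := kx k kI.
  have [lI|lI] := boolP (l \in codom I); last first.
    move: mkl; rewrite herbst_exponentN//; have [<- _|_] := eqVneq l k.
      by rewrite xl.
    by rewrite muln0.
  have [j jl] := codomP lI.
  (* As [x_(I j) = 0], the nonnegative sum equals [- (L s)_j]; its term at [k] carries an exponent
     at least 1 and so dominates [x_k]. *)
  have := fiber_coord ih x j; rewrite -jl xl mulr0 Qx => /eqP.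
  rewrite eq_sym addr_eq0 => /eqP Lj.
  apply: le_trans (leB j); rewrite Lj normrN ger0_norm; last first.
    by apply: sumr_ge0 => k' _; rewrite mulr_ge0.
  rewrite (bigD1 k)//=; apply: (@le_trans _ _ ((m k l)%:R * x k 0)).
    by rewrite ler_peMl// ler1n lt0n.
  by rewrite jl lerDl sumr_ge0// => k' _; rewrite mulr_ge0.
have [iI|iI] := boolP (i \in codom I); last first.
  by apply: le_trans (xk _ iI) _; rewrite ler_peMr// lerDl.
have [j jl] := codomP iI.
apply: (@le_trans _ _ (D%:R * x i 0)); first by rewrite ler_peMl.
rewrite jl (fiber_coord ih) Qx mulrDr mulr1 lerD//.
  exact: le_trans (ler_norm _) (leB j).
rewrite mulr_sumr big_mkcond; apply: ler_sum => k _.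
case: ifPn => kI; last by rewrite mulr_ge0// sumr_ge0.
rewrite mulrC ler_pM// ?xk// (bigD1 (I j))//= lerDl sumr_ge0//.
Qed.

Lemma critical_locus_herbst_compact s :
  compact (critical_locus Q herbst_potential s).
Proof.
rewrite critical_locus_herbst.
set Z := [set w : 'cV[C]_N | _].
(* [compact_subtype] asks for a subset of the fiber, which [Z] need not be; the intersection has the
   same preimage. *)
have -> : set_val @^-1` Z =
    @set_val _ (moment_fiber Q s) @^-1` (moment_fiber Q s `&` Z).
  by apply/seteqP; split=> w /=; [split=> //; exact: set_valP | case].
apply: continuous_compact.
  by apply: continuous_subspaceT; exact: pi_continuous.
apply: compact_subtype; first by move=> w [].
have [M Mb] := herbst_fiber_bounded s.
apply: (@subclosed_compact _ _ [set w : 'cV[C]_N | forall i,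
    [set z : C | `|complex.Re z| <= 1 + 2 * M /\ `|complex.Im z| <= 1 + 2 * M] (w i 0)]).
- apply: closedI; first exact: moment_fiber_closed.
  have -> : Z = \bigcap_(k in [set k | k \notin codom I])
      [set w : 'cV[C]_N | monomial (m k) w = 0].
    by apply/seteqP; split=> w wk k; exact: wk.
  apply: closed_bigI => k _.
  apply: (@preimage_closed _ _ (monomial (m k) : 'cV[C]_N -> C) [set x | x = 0]).
    by move=> w _; apply: differentiable_continuous; exact: differentiable_monomial.
  exact: (compact_closed (@norm_hausdorff _ C) (@compact_set1 C 0)).
- apply: (@cV_compact R N (fun=> [set z : C |
      `|complex.Re z| <= 1 + 2 * M /\ `|complex.Im z| <= 1 + 2 * M])) => i.
  exact: complex_box_compact.
- move=> w /= [ws wk] i; apply: moment_le_box; apply: Mb => //.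
    exact: moment_ge0.
  move=> k kI; have /eqP/monomial_eq0P[l ml wl] := wk k kI.
  by exists l => //; apply/eqP; rewrite moment_eq0 wl.
Qed.

End HerbstPotential.

(** * The stability parameter with a single critical orbit *)

(** With [J := const_mx 1], [J^2 = n J] gives the inverse [1 - J / (n + 1)]. The columns of [1 + J]
    are positive and independent, which will show that a phase has full dimension. *)
Lemma add1_const_unit (K : numFieldType) (n : nat) :
  (1%:M + const_mx 1 : 'M[K]_n) \in unitmx.
Proof.
have : (1%:M + const_mx 1) *m (1%:M - n.+1%:R^-1 *: const_mx 1) = 1%:M :> 'M[K]_n.
  have JJ : (const_mx 1 : 'M[K]_n) *m (const_mx 1 : 'M[K]_n) = n%:R *: const_mx 1.
    apply/matrixP => i j; rewrite !mxE.
    under eq_bigr => k _ do rewrite !mxE mulr1.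
    by rewrite sumr_const card_ord mulr1.
  rewrite mulmxBr mulmx1 -scalemxAr mulmxDl mul1mx JJ.
  rewrite -[X in _ *: (X + _)]scale1r -scalerDl scalerA.
  by rewrite (addrC 1 n%:R) natr1 mulVf ?pnatr_eq0// scale1r addrK.
by case/mulmx1_unit.
Qed.

Lemma rank_left_inverse (K : fieldType) (p q : nat) (A : 'M[K]_(p, q)) B :
  B *m A = 1%:M -> \rank A = q.
Proof.
move=> BA; apply/eqP; rewrite eqn_leq rank_leq_col/=.
by rewrite -{1}(mxrank1 K q) -BA mxrankM_maxr.
Qed.

Section HerbstAffine.
Variables (R : realType) (rho N r : nat) (Q : 'M[int]_(rho, N)) (I : 'I_r -> 'I_N).
Variables (L : 'M[int]_(r, rho)) (D : nat).
Hypothesis ih : integral_herbst Q I L D.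
Local Notation m := (herbst_exponent Q I L D).
Local Notation C := (Cplx R).
Local Notation Qr := (realmx R Q).
Local Notation Lr := (map_mx intr L : 'M[R]_(r, rho)).

Definition column_embedding : 'M[R]_(N, r) := colsub I 1%:M.
Local Notation E := column_embedding.
Local Notation one := (const_mx 1 : 'cV[R]_r).

Lemma column_embedding_in (c : 'cV[R]_r) j : (E *m c) (I j) 0 = c j 0.
Proof. exact/colsub1_mul_in/(ih_inj ih). Qed.

Lemma column_embedding_notin (c : 'cV[R]_r) l : l \notin codom I -> (E *m c) l 0 = 0.
Proof. exact: colsub1_mul_notin. Qed.

Lemma left_inverse_embedding p (c : 'M[R]_(r, p)) : Lr *m (Qr *m (E *m c)) = D%:R *: c.
Proof.
rewrite !mulmxA -mulmxA -mulmxA [Qr *m (E *m c)]mulmxA.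
have -> : Qr *m E = map_mx intr (colsub I Q).
  by rewrite -colsub_mul; apply/matrixP => i j; rewrite !mxE.
by rewrite mulmxA -map_mxM (ih_inv ih) map_scalar_mx/= -pmulrn mul_scalar_mx.
Qed.

Lemma D_gt0 : 0 < D%:R :> R. Proof. by rewrite ltr0n (ih_D ih). Qed.

(** [fiber_coord] writes [D x_(I j)] as [D c_j] plus nonnegative terms. *)
Lemma fiber_coord_gt0 (c : 'cV[R]_r) (x : 'cV[R]_N) :
  (forall j, 0 < c j 0) -> (forall i, 0 <= x i 0) ->
  Qr *m x = Qr *m (E *m c) -> forall j, 0 < x (I j) 0.
Proof.
move=> c0 x0 Qx j; rewrite -(pmulr_rgt0 _ D_gt0) (fiber_coord ih) Qx.
rewrite left_inverse_embedding mxE ltr_pwDl ?mulr_gt0 ?D_gt0//.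
by apply: sumr_ge0 => k _; rewrite mulr_ge0.
Qed.

(** Every nonnegative preimage is positive on [I], and [E c] is one supported on [I]. The answer is
    independent of [c], so all positive combinations of the selected columns share one relative
    interior. *)
Lemma col_cone_herbst (c : 'cV[R]_r) (S : {set 'I_N}) : (forall j, 0 < c j 0) ->
  col_cone Q S (Qr *m (E *m c)) <-> (forall j, I j \in S).
Proof.
move=> c0; split=> [[x /= xS Qx] j|IS].
  have /lt0r_neq0 := fiber_coord_gt0 c0 (fun i => (xS i).1) Qx j.
  by apply: contra_neqT => /(xS _).2.
exists (E *m c) => //= i; have [iI|iI] := boolP (i \in codom I).
  have [j ->] := codomP iI; rewrite column_embedding_in IS; split=> //.
  exact/ltW.
by rewrite column_embedding_notin.
Qed.

Lemma secondary_relint_herbst (c d : 'cV[R]_r) : (forall j, 0 < c j 0) ->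
  (forall j, 0 < d j 0) ->
  secondary_relint Q (Qr *m (E *m c)) (Qr *m (E *m d)).
Proof.
move=> c0 d0; split=> [|S]; first by apply/col_cone_herbst => // j; rewrite inE.
by rewrite !col_cone_herbst.
Qed.

Definition herbst_stability : 'cV[R]_rho := Qr *m (E *m one).

Lemma herbst_stability_phase : r = charge_rank R Q ->
  phase Q (secondary_relint Q herbst_stability).
Proof.
move=> rE; exists herbst_stability; split=> //.
  by apply/col_cone_herbst => j; rewrite ?inE// mxE ltr01.
rewrite -rE; exists (Qr *m (E *m (1%:M + const_mx 1))); split.
  apply: (@rank_left_inverse _ _ _ _ (D%:R^-1 *: (invmx (1%:M + const_mx 1) *m Lr))).
  rewrite -scalemxAl -mulmxA left_inverse_embedding -scalemxAr scalerA.
  by rewrite mulVf ?lt0r_neq0 ?D_gt0// scale1r mulVmx// add1_const_unit.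
move=> j; rewrite !col_mulmx; apply: secondary_relint_herbst => i.
  by rewrite mxE ltr01.
by rewrite !mxE ltr_wpDl ?ler0n ?ltr01.
Qed.

(** With zero left-hand side [Q d], [fiber_coord] expresses the coordinates in [I] through the
    others. *)
Lemma ker_determined (d : 'cV[R]_N) : Qr *m d = 0 ->
  (forall k, k \notin codom I -> d k 0 = 0) -> d = 0.
Proof.
move=> Qd d0; apply/colP => i; rewrite [RHS]mxE.
have [/codomP[j ->]|/d0//] := boolP (i \in codom I).
have := fiber_coord ih d j.
rewrite Qd mulmx0 mxE add0r big1 => [/eqP|k /d0 ->]; last by rewrite mulr0.
by rewrite mulf_eq0 pnatr_eq0 -leqn0 leqNgt (ih_D ih) => /eqP.
Qed.

(** The lift of [s] is 1 on [I] and 0 elsewhere. In [ker Q], nonnegativity outside [I] implies it on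
    [I], so [P_s] is the cone with apex 0 spanned by the exponent vectors of the [S_k]. *)
Lemma herbst_affine_point : r = charge_rank R Q -> affine_point Q herbst_stability.
Proof.
move=> rE; split.
  exists (secondary_relint Q herbst_stability); split.
    exact: herbst_stability_phase.
  by apply: secondary_relint_herbst => j; rewrite mxE ltr01.
exists (E *m one); split=> //; rewrite -rE.
have [K Kinj KI] : exists2 K : 'I_(N - r) -> 'I_N, injective K &
    forall k, (k \in codom K) = (k \in [set l | l \notin codom I]%SET).
  have : (r + #|[set l | l \notin codom I]%SET|)%N = N.
    have := cardC (mem (codom I)); rewrite card_codom ?card_ord; last exact: ih_inj ih.
    move=> rN; rewrite -[RHS]rN.
    by congr addn; apply: eq_card => l; rewrite !inE.
  by move=> rN; apply: enum_injection; rewrite -[X in (X - r)%N]rN addKn.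
have KnI b : K b \notin codom I by have := KI (K b); rewrite codom_f inE => /esym.
pose G : 'M[R]_(N, N - r) := \matrix_(l, b) (m (K b) l)%:R.
have GK (c : 'cV[R]_(N - r)) b : (G *m c) (K b) 0 = D%:R * c b 0.
  rewrite mxE (bigD1 b)//= mxE herbst_exponentN// eqxx muln1 big1 ?addr0// => b' b'b.
  by rewrite mxE herbst_exponentN// (inj_eq Kinj) eq_sym (negPf b'b) muln0 mul0r.
have QG : Qr *m G = 0.
  apply/matrixP => a b; rewrite [RHS]mxE.
  have := congr1 (fun x => x%:~R : R) (herbst_exponent_charge ih a (KnI b)).
  rewrite rmorph_sum/= mxE => E0; rewrite -[RHS]E0.
  by apply: eq_bigr => l _; rewrite !mxE rmorphM.
exists 0, G; split=> //; first by rewrite mulmx0.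
  apply: (@rank_left_inverse _ _ _ _ (D%:R^-1 *: rowsub K 1%:M)).
  apply/matrixP => b b'; rewrite -scalemxAl mul_rowsub_mx mul1mx.
  rewrite !mxE herbst_exponentN// (inj_eq Kinj) natrM mulrA mulVf ?mul1r//.
  exact/lt0r_neq0/D_gt0.
apply/seteqP; split=> [x [/= Qx x0]|_ [c /= c0 <-]].
  (* Among the columns of [G] only the one of index [b] is nonzero at [K b], where it is [D]; this
     dictates the coefficients. *)
  exists (\col_b (D%:R^-1 * x (K b) 0)) => [b/=|].
    rewrite mxE mulr_ge0// ?invr_ge0//.
    by have := x0 (K b); rewrite column_embedding_notin// addr0.
  apply/eqP; rewrite add0r -subr_eq0; apply/eqP; apply: ker_determined.
    by rewrite mulmxBr mulmxA QG mul0mx Qx subr0.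
  move=> k kI; have /codomP[b ->] : k \in codom K by rewrite KI inE.
  by rewrite mxE [X in _ + X]mxE GK mxE mulrA mulfV ?mul1r ?subrr// lt0r_neq0 ?D_gt0.
rewrite add0r; split; first by rewrite /= mulmxA QG mul0mx.
move=> i; apply: addr_ge0.
  by rewrite mxE sumr_ge0// => b _; rewrite mxE mulr_ge0.
have [/codomP[j ->]|iI] := boolP (i \in codom I).
  by rewrite column_embedding_in mxE ler01.
by rewrite column_embedding_notin.
Qed.

(** Row [j] of [L], read as a one-parameter subgroup, acts on [z_(I j)] with weight [D] and
    trivially on the rest of [I], so the arguments can be adjusted independently. *)
Lemma compact_torus_transitive (w1 w2 : 'cV[C]_N) :
  (forall l, l \notin codom I -> w1 l 0 = 0 /\ w2 l 0 = 0) ->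
  (forall j, w1 (I j) 0 != 0 /\ `|w1 (I j) 0| = `|w2 (I j) 0|) ->
  exists u, in_compact_torus u /\ w2 = torus_act Q u w1.
Proof.
move=> wnI wI; have D0 := ih_D ih.
pose t j : C := w2 (I j) 0 / w1 (I j) 0.
have t1 j : `|t j| = 1.
  have [w10 wE] := wI j; rewrite /t normrM normfV -wE divff// normr_eq0//.
(* As [L Q_I = D], the wanted phases are reached from [D]-th roots. *)
pose om j : C := D.-root (t j).
have om1 j : `|om j| = 1.
  by apply/eqP; rewrite -(@pexpr_eq1 _ _ D)// -normrX rootCK// t1.
have om0 j : om j != 0 by rewrite -normr_eq0 om1 oner_neq0.
exists (\col_a \prod_j om j ^ L j a); split=> [a|].
  rewrite mxE normr_prod big1// => j _.
  by case: (L j a) => n; rewrite ?NegzE -?exprnN ?normfV normrX om1 expr1n ?invr1.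
apply/colP => l; rewrite mxE.
have [/codomP[i ->]|lI] := boolP (l \in codom I); last first.
  by have [-> ->] := wnI l lI; rewrite mulr0.
rewrite [X in X * _](_ : _ = t i); last first.
  have omX j : \prod_a om j ^ (L j a * Q a (I i)) = om j ^ (D * (j == i))%N.
    have -> : ((D * (j == i))%N : int) = \sum_a L j a * Q a (I i).
      have /matrixP/(_ j i) := ih_inv ih; rewrite !mxE => E.
      have -> : ((D * (j == i))%N : int) = D%:Z *+ (j == i).
        by case: (j == i); rewrite ?muln1 ?muln0.
      by rewrite -E; apply: eq_bigr => a _; rewrite mxE.
    elim/big_rec2: _ => [|a p q _ ->]; first by rewrite expr0z.
    by rewrite expfzDr.
  transitivity (\prod_a \prod_j om j ^ (L j a * Q a (I i))).
    apply: eq_bigr => a _; rewrite mxE.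
    elim/big_rec2: _ => [|j p q _ <-]; first by rewrite exp1rz.
    by rewrite expfzMl exprz_exp.
  rewrite exchange_big (bigD1 i)//= [X in _ * X]big1 => [|j ji]; last first.
    by rewrite omX (negPf ji) muln0 expr0z.
  by rewrite mulr1 omX eqxx muln1 -exprnP rootCK.
by rewrite /t divfK//; have [] := wI i.
Qed.

Lemma critical_locus_herbst_stability : exists x : toric_quotient Q herbst_stability,
  critical_locus Q (@herbst_potential R rho N r Q I L D) herbst_stability = [set x].
Proof.
(* A point with moment [E *m one]: [sqrt 2] on [I], zero elsewhere. *)
pose z : 'cV[C]_N := \col_l (Num.sqrt (2 * (E *m one) l 0))%:C%C.
have st0 l : 0 <= (E *m one) l 0.
  have [/codomP[j ->]|lI] := boolP (l \in codom I).
    by rewrite column_embedding_in mxE ler01.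
  by rewrite column_embedding_notin.
have mz : moment z = E *m one.
  apply/colP => l; rewrite mxE /z mxE /= expr0n addr0 sqr_sqrtr; last by rewrite mulr_ge0.
  by rewrite mulrA mulVf ?mul1r// pnatr_eq0.
have zs : z \in moment_fiber Q herbst_stability by rewrite inE /moment_fiber /= mz.
exists (toric_class (exist _ z zs)).
have zI j : z (I j) 0 != 0.
  by rewrite -moment_eq0 mz column_embedding_in mxE oner_neq0.
have znI l : l \notin codom I -> z l 0 = 0.
  by move=> lI; apply/eqP; rewrite -moment_eq0 mz column_embedding_notin.
rewrite (critical_locus_herbst ih); apply/seteqP; split=> [_ [w /= w0 <-]|_ ->]; last first.
  exists (exist _ z zs) => //= k kI; apply/eqP/monomial_eq0P; exists k; last exact: znI.
  by rewrite herbst_exponentN// eqxx muln1 -lt0n (ih_D ih).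
have Qw : Qr *m moment (set_val w) = Qr *m (E *m one) by exact: set_valP w.
have c0 (j : 'I_r) : 0 < (const_mx 1 : 'cV[R]_r) j 0 by rewrite mxE ltr01.
have wI j : set_val w (I j) 0 != 0.
  by rewrite -moment_eq0 lt0r_neq0// (fiber_coord_gt0 c0 _ Qw)// => i; exact: moment_ge0.
have wnI k : k \notin codom I -> set_val w k 0 = 0.
  move=> kI; have /eqP/monomial_eq0P[l ml wl] := w0 k kI.
  have [/codomP[j lE]|lI] := boolP (l \in codom I).
    by have := wI j; rewrite -lE wl eqxx.
  move: ml; rewrite herbst_exponentN//.
  by have [<- _|_] := eqVneq l k; last by rewrite muln0.
(* Both moments have the same image under [Q] and vanish outside [I], hence agree; the moduli then
   agree too, which leaves one compact orbit. *)
have mw : moment (set_val w) = moment z.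
  apply/eqP; rewrite -subr_eq0; apply/eqP; apply: ker_determined.
    by rewrite mulmxBr Qw mz subrr.
  move=> k kI; have := moment_eq0 (set_val w) k; have := moment_eq0 z k.
  rewrite wnI// znI// eqxx [X in _ -> _ -> X = 0]mxE.
  by rewrite [X in _ -> _ -> _ + X = 0]mxE => /eqP -> /eqP ->; rewrite subrr.
have normE (a b : 'cV[C]_N) i : moment a = moment b -> `|a i 0| = `|b i 0|.
  move=> /colP/(_ i); rewrite !mxE => /(mulfI _) ab.
  by rewrite !normc_def ab// invr_eq0 pnatr_eq0.
have [u [u1 uE]] := @compact_torus_transitive (set_val w) z
  (fun l lI => conj (wnI l lI) (znI l lI)) (fun j => conj (wI j) (normE _ _ _ mw)).
rewrite /toric_class; apply/eqmodP; apply/asboolP; exists u; split=> //.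
Qed.

End HerbstAffine.

(** * From affine points to the Herbst Criterion *)

Lemma small_step_ge0 (R : realType) (N : nat) (p d : 'cV[R]_N) :
  (forall i, 0 <= p i 0) -> (forall i, p i 0 = 0 -> 0 <= d i 0) ->
  exists2 e, 0 < e & forall i, 0 <= p i 0 + e * d i 0.
Proof.
(* Division by zero gives 0, so coordinates with [p_i = 0] add nothing to [S]; for the others
   [|d_i| <= S p_i]. *)
move=> p0 d0; pose S := \sum_i `|d i 0| / p i 0.
have t0 i : 0 <= `|d i 0| / p i 0 by rewrite mulr_ge0 ?invr_ge0.
have S1 : 0 < 1 + S by rewrite ltr_pwDl// sumr_ge0.
exists (1 + S)^-1 => [|i]; first by rewrite invr_gt0.
have [pi0|pi0] := eqVneq (p i 0) 0.
  by rewrite pi0 add0r mulr_ge0 ?invr_ge0 ?(ltW S1)// d0.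
rewrite -(pmulr_rge0 _ S1) mulrDr mulrA mulfV ?lt0r_neq0// mul1r.
have dS : `|d i 0| <= S * p i 0.
  rewrite -ler_pdivrMr ?lt0r ?pi0 ?p0//.
  by rewrite /S (bigD1 i)//= lerDl sumr_ge0.
by have := p0 i; have := ler_norm (- d i 0); rewrite normrN; lra.
Qed.

Lemma rank_colsub_ker0 (K : fieldType) (p q n : nat) (A : 'M[K]_(p, q)) (f : 'I_n -> 'I_q) :
  (forall c : 'cV[K]_n, colsub f A *m c = 0 -> c = 0) -> \rank (colsub f A) = n.
Proof.
move=> inj; rewrite -mxrank_tr; apply/eqP; rewrite -/(row_free _).
apply: inj_row_free => v vA; apply: trmx_inj; rewrite trmx0; apply: inj.
by apply: trmx_inj; rewrite trmx_mul trmxK vA trmx0.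
Qed.

Lemma affine_point_herbst (R : realType) (rho N : nat) (Q : 'M[int]_(rho, N))
  (s : 'cV[R]_rho) : affine_point Q s -> herbst R Q.
Proof.
move=> [[_ [[s' [_ -> [B [rB Bs]]]] [_ ss']]] [st [Qst [v [G [Qv QG rG PE]]]]]].
(* The values at the apex of the [N] inequalities that define [P_s]. *)
pose p : 'cV[R]_N := v + st.
have Qp : realmx R Q *m p = s by rewrite mulmxDr Qv add0r.
have coneP (c : 'cV[R]_(N - charge_rank R Q)) :
    (forall k, 0 <= c k 0) -> forall i, 0 <= p i 0 + (G *m c) i 0.
  move=> c0 i; have : polyhedron Q st (v + G *m c) by rewrite PE; exists c.
  by move=> [_ /(_ i)]; rewrite /p !mxE; lra.
have p0 i : 0 <= p i 0.
  have := coneP 0 (fun k => _) i; rewrite mulmx0 [X in _ + X]mxE addr0.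
  by apply => k; rewrite mxE.
have Ginj (c : 'cV[R]_(N - charge_rank R Q)) : G *m c = 0 -> c = 0.
  have /row_fullP[B' B'G] : row_full G by rewrite /row_full rG.
  by move=> Gc; rewrite -[c]mul1mx -B'G -mulmxA Gc mulmx0.
(* Such a direction stays in [P_s] for a short step from the apex, so it belongs to the cone
   generated by [G]. *)
have dirP (d : 'cV[R]_N) : realmx R Q *m d = 0 ->
    (forall i, p i 0 = 0 -> 0 <= d i 0) ->
    exists2 c : 'cV[R]_(N - charge_rank R Q), (forall k, 0 <= c k 0) & d = G *m c.
  move=> Qd d0; have [e e0 pe] := small_step_ge0 p0 d0.
  have : polyhedron Q st (v + e *: d).
    split; first by rewrite /= mulmxDr Qv -scalemxAr Qd scaler0 addr0.
    by move=> i; have := pe i; rewrite /p !mxE; lra.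
  rewrite PE => -[c c0 /addrI E]; exists (e^-1 *: c) => [k|].
    by rewrite mxE mulr_ge0 ?invr_ge0 ?(ltW e0)//; exact: c0.
  by rewrite -scalemxAr E scalerA mulVf ?scale1r// lt0r_neq0.
pose J := [set i | p i 0 != 0]%SET.
(* As the cone is pointed, it cannot contain both of two opposite directions. *)
have freeJ n (f : 'I_n -> 'I_N) : injective f -> (forall i, (i \in codom f) = (i \in J)) ->
    \rank (colsub f (realmx R Q)) = n.
  move=> finj fJ; apply: rank_colsub_ker0 => c; rewrite colsub_mul -mulmxA => Qc.
  have out i : p i 0 = 0 -> (colsub f 1%:M *m c) i 0 = 0.
    by move=> pi; apply: colsub1_mul_notin; rewrite fJ inE pi eqxx.
  have [c1 c10 E1] : exists2 c1 : 'cV[R]_(N - charge_rank R Q), (forall k, 0 <= c1 k 0) &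
      colsub f 1%:M *m c = G *m c1.
    by apply: dirP => // i /out ->.
  have [c2 c20 E2] : exists2 c2 : 'cV[R]_(N - charge_rank R Q), (forall k, 0 <= c2 k 0) &
      - (colsub f 1%:M *m c) = G *m c2.
    by apply: dirP => [|i /out E]; [rewrite mulmxN Qc oppr0|rewrite mxE E oppr0].
  have c12 : c1 + c2 = 0 by apply: Ginj; rewrite mulmxDr -E1 -E2 subrr.
  have c1E : c1 = 0.
    apply/colP => k; have := c10 k; have := c20 k.
    by move/colP: c12 => /(_ k); rewrite !mxE; lra.
  apply/colP => j; rewrite -(colsub1_mul_in c j finj).
  by rewrite E1 c1E mulmx0 !mxE.
(* By stability, [s] lies in no cone generated by columns of lower rank. *)
have rJ : #|J| = charge_rank R Q.
  have [f finj fJ] := @enum_injection _ J _ erefl.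
  apply/eqP; rewrite eqn_leq -{1}(freeJ _ f finj fJ) colsub_mul mxrankM_maxl /=.
  (* [p] puts [s] in the cone of [J]; points of a phase lie in the same cones, so the columns of [B]
     are there too and [B] factors through the columns in [J]. *)
  have Bcol j : exists c : 'cV[R]_#|J|, col j B = colsub f (realmx R Q) *m c.
    have sJ : col_cone Q J s.
      by exists p => //= i; split=> //; rewrite inE negbK => /eqP.
    have /(_ J)[_ toB] := (Bs j).2.
    have /(_ J)[to' _] := ss'.
    have [x /= xJ Qx] := toB (to' sJ).
    exists (\col_j x (f j) 0); rewrite colsub_mul -mulmxA -Qx; congr (_ *m _).
    apply/colP => i; have [iJ|iJ] := boolP (i \in J).
      by move: (iJ); rewrite -fJ => /codomP[j' ->]; rewrite colsub1_mul_in// mxE.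
    by rewrite (xJ i).2// colsub1_mul_notin// fJ.
  have [X XE] := choice Bcol.
  rewrite -rB -(freeJ _ f finj fJ).
  have -> : B = colsub f (realmx R Q) *m \matrix_(i, j) X j i 0.
    apply/matrixP => i j; have /colP/(_ i) := XE j; rewrite !mxE => ->.
    by apply: eq_bigr => l _; rewrite !mxE.
  exact: mxrankM_maxl.
have [I Iinj IJ] := enum_injection rJ.
have rI := freeJ _ I Iinj IJ.
exists I; split=> // k kI.
have {}kI : k \notin codom I by apply/codomP => -[j kE]; have := kI j; rewrite kE eqxx.
have [Y QY] : exists Y, realmx R Q = colsub I (realmx R Q) *m Y.
  have /submxP[Y QY] : ((realmx R Q)^T <= (colsub I (realmx R Q))^T)%MS.
    have sub : ((colsub I (realmx R Q))^T <= (realmx R Q)^T)%MS.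
      by rewrite colsub_mul trmx_mul submxMl.
    by rewrite -(geq_leqif (mxrank_leqif_sup sub)) !mxrank_tr rI.
  by exists Y^T; apply: trmx_inj; rewrite trmx_mul trmxK.
have QkY : col k (realmx R Q) = colsub I (realmx R Q) *m col k Y.
  by rewrite [in LHS]QY col_mulmx.
exists (col k Y); split=> //.
(* The linear relation between [q_k] and the columns in [I], as a kernel vector. Outside [I], where
   [p] vanishes, it is the indicator of [k], so [dirP] applies. *)
pose d := delta_mx k 0 - colsub I 1%:M *m col k Y : 'cV[R]_N.
have Qd : realmx R Q *m d = 0.
  by rewrite mulmxBr -colE mulmxA -colsub_mul QkY subrr.
have d_out i : i \notin codom I -> d i 0 = (i == k)%:R.
  by move=> iI; rewrite /d [LHS]mxE [X in _ + X]mxE colsub1_mul_notin// subr0 mxE andbT.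
have [c c0 dE] : exists2 c : 'cV[R]_(N - charge_rank R Q),
    (forall k, 0 <= c k 0) & d = G *m c.
  by apply: dirP => // i pi; rewrite d_out ?IJ ?inE ?pi ?eqxx.
move=> j; rewrite leNgt; apply/negP => Yj.
have dj : d (I j) 0 = - col k Y j 0.
  rewrite /d [LHS]mxE [X in _ + X]mxE colsub1_mul_in// [X in X - _]mxE.
  rewrite (_ : (I j == k) = false) ?sub0r//.
  by apply: contraNF kI => /eqP <-; exact: codom_f.
(* At the apex plus [t d], the inequality of index [I j] takes the value [-1], although the whole
   ray lies in [P_s]. *)
pose t := (p (I j) 0 + 1) / col k Y j 0.
have t0 : 0 <= t by rewrite divr_ge0 ?addr_ge0// ltW.
have tY : t * col k Y j 0 = p (I j) 0 + 1 by rewrite divfK// lt0r_neq0.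
have tc k0 : 0 <= (t *: c) k0 0 by rewrite mxE mulr_ge0.
have td : (t *: d) (I j) 0 = t * d (I j) 0 by rewrite [LHS]mxE.
have := coneP _ tc (I j); rewrite -scalemxAr -dE td dj mulrN tY.
by lra.
Qed.

Theorem theorem3p11 (R : realType) (rho N : nat) (Q : 'M[int]_(rho, N)) :
  let a :=
    herbst R Q /\
    exists W : 'cV[Cplx R]_N -> Cplx R,
      [/\ holomorphic W, torus_invariant Q W
        & exists sigma : set 'cV[R]_rho,
            phase Q sigma /\ compact_critical_locus_in Q W sigma] in
  let b :=
    herbst R Q /\
    exists W : 'cV[Cplx R]_N -> Cplx R,
      [/\ holomorphic W, torus_invariant Q W
        & forall sigma : set 'cV[R]_rho,
            phase Q sigma -> compact_critical_locus_in Q W sigma] in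
  let c :=
    exists s : 'cV[R]_rho, affine_point Q s /\
    exists W : 'cV[Cplx R]_N -> Cplx R,
      [/\ holomorphic W, torus_invariant Q W
        & exists x : toric_quotient Q s, critical_locus Q W s = [set x]] in
  (a <-> b) /\ (b <-> c).
Proof.
move=> a b c.
have ha : a -> herbst R Q by move=> [].
have hb : herbst R Q -> b.
  move=> h; split=> //; have [I [L [D ih]]] := herbst_integral h.
  exists (@herbst_potential R rho N _ Q I L D); split.
  - exact: herbst_potential_holomorphic.
  - exact: herbst_potential_invariant ih.
  - by move=> sigma _ s _; exact: critical_locus_herbst_compact.
(* Some phase has to exist here; the criterion provides the one of [herbst_stability]. *)
have ba : b -> a.
  move=> [h [W [hW tW cW]]]; split=> //; exists W; split=> //.
  have [I [L [D ih]]] := herbst_integral h.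
  have ph := herbst_stability_phase ih erefl.
  by exists (secondary_relint Q (herbst_stability R Q I)); split=> //; exact: cW.
have hc : herbst R Q -> c.
  move=> h; have [I [L [D ih]]] := herbst_integral h.
  exists (herbst_stability R Q I); split; first exact: herbst_affine_point ih erefl.
  exists (@herbst_potential R rho N _ Q I L D); split.
  - exact: herbst_potential_holomorphic.
  - exact: herbst_potential_invariant ih.
  - exact: critical_locus_herbst_stability ih.
have ch : c -> herbst R Q by move=> [s [/affine_point_herbst]].
split; split.
- by move=> x; exact: hb (ha x).
- exact: ba.
- by move=> x; exact: hc (ha (ba x)).
- by move=> x; exact: hb (ch x).
Qed.
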